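(* Let $L^{m}$ be an $m$-dimensional Einstein manifold, let $\lambda\ge 0$ be a real constant, and let $\varphi:M^{m}\to L^{m}\times\mathbb{R}$ be a totally umbilical $\lambda$-biharmonic hypersurface whose angle function $\theta=\langle\partial_t,\xi\rangle$ is constant. Then $M^{m}$ is minimal (i.e. $H\equiv 0$), or $M^{m}$ is a vertical cylinder over a $\lambda$-biharmonic hypersurface in $L^{m}$.
   Context: Manifolds are smooth and, as usual, connected. $L^m$ Einstein means $\mathrm{Ric}^{L}=\mu g^{L}$ with $\mu$ a constant; $L^m\times\mathbb{R}$ carries the product metric $g^{L}+dt^2$, and $\partial_t$ is the unit vector field tangent to the $\mathbb{R}$ factor. For a smooth map $\varphi:(M,g)\to (Q,g^Q)$ of Riemannian manifolds, the tension field is $\tau(\varphi)=\mathrm{tr}_g(\nabla d\varphi)$ and the bitension field is $\tau_2(\varphi)=\mathrm{tr}_g(\nabla^\varphi\nabla^\varphi-\nabla^\varphi_{\nabla^M})\tau(\varphi)-\mathrm{tr}_g\widetilde R(d\varphi,\tau(\varphi))d\varphi$, where $\nabla^\varphi$ is the induced connection on $\varphi^{-1}TQ$, $\nabla^M$ the Levi-Civita connection of $M$, and $\widetilde R(X,Y)Z=\widetilde\nabla_X\widetilde\nabla_YZ-\widetilde\nabla_Y\widetilde\nabla_XZ-\widetilde\nabla_{[X,Y]}Z$ the curvature of $Q$. For a real constant $\lambda$, $\varphi$ is called $\lambda$-biharmonic if $\tau_2(\varphi)-\lambda\tau(\varphi)=0$. A $\lambda$-biharmonic hypersurface is a codimension-one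 isometric immersion that is a $\lambda$-biharmonic map. A hypersurface $\varphi:M^m\to L^m\times\mathbb{R}$ has unit normal field $\xi$, second fundamental form $B$, shape operator $A$ with $\langle B(X,Y),\xi\rangle=\langle AX,Y\rangle$, and mean curvature $H=\frac1m\mathrm{tr}A$. It is totally umbilical if $\langle B(X,Y),\xi\rangle=H\langle X,Y\rangle$ for all tangent $X,Y$. A vertical cylinder over a hypersurface $\bar M^{m-1}$ of $L^m$ is (an open part of) $\bar M^{m-1}\times\mathbb{R}\subset L^m\times\mathbb{R}$, in the local sense: every point of $M$ has a neighbourhood whose image is an open subset of such a product; equivalently $\partial_t$ is everywhere tangent to $M$. The $\lambda$ for the hypersurface in $L^m$ is the same $\lambda$. *)

(* Defs.v *)
From HB Require Import structures.
From mathcomp Require Import all_boot all_order all_algebra.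
From mathcomp Require Import all_classical all_reals all_analysis.

Set Implicit Arguments.
Unset Strict Implicit.
Unset Printing Implicit Defensive.

Import Order.TTheory GRing.Theory Num.Theory.
Import numFieldNormedType.Exports.

Local Open Scope classical_set_scope.
Local Open Scope ring_scope.

(* Coordinate vectors are row vectors: the differential of f at x sends u to
   u *m 'J f x. *)

Section Smooth.
Context {R : realType} {V W : normedModType R}.

(* C^k on a set U, meant for U open *)
Fixpoint Ck (k : nat) (U : set V) (f : V -> W) : Prop :=
  if k is k'.+1 then
    (forall x, U x -> differentiable f x) /\
    (forall v : V, Ck k' U (fun x => 'D_v f x))
  else forall x, U x -> {for x, continuous f}.

Definition smooth_on (U : set V) (f : V -> W) : Prop := forall k, Ck k U f.

End Smooth.

Section LocalGeometry.
Context {R : realType}.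

Definition evec {n} (i : 'I_n) : 'rV[R]_n := delta_mx 0 i.

Definition inner {n} (G : 'M[R]_n) (u v : 'rV[R]_n) : R :=
  (u *m G *m v^T) 0 0.

(* Gamma_{ij}^k of a metric g given in coordinates *)
Definition christoffel {n} (g : 'rV[R]_n -> 'M[R]_n) (x : 'rV[R]_n)
    (i j k : 'I_n) : R :=
  2^-1 * \sum_l invmx (g x) k l *
    ('D_(evec i) (fun y => g y j l) x
     + 'D_(evec j) (fun y => g y i l) x
     - 'D_(evec l) (fun y => g y i j) x).

Definition christoffel_bilin {n} (g : 'rV[R]_n -> 'M[R]_n) (x u v : 'rV[R]_n) :
    'rV[R]_n :=
  \row_k \sum_i \sum_j u 0 i * v 0 j * christoffel g x i j k.

Definition bracket {n} (X Y : 'rV[R]_n -> 'rV[R]_n) : 'rV[R]_n -> 'rV[R]_n :=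
  fun x => 'D_(X x) Y x - 'D_(Y x) X x.

(* df(X), a vector field along f *)
Definition pushforward {m n} (f : 'rV[R]_m -> 'rV[R]_n)
    (X : 'rV[R]_m -> 'rV[R]_m) : 'rV[R]_m -> 'rV[R]_n :=
  fun x => 'D_(X x) f x.

(* nabla^f_X V, for the connection induced on f^{-1}T(R^n, h) by the
   Levi-Civita connection [cov h] and a vector field V along f *)
Definition cov_along {m n} (h : 'rV[R]_n -> 'M[R]_n)
    (f : 'rV[R]_m -> 'rV[R]_n) (X : 'rV[R]_m -> 'rV[R]_m)
    (V : 'rV[R]_m -> 'rV[R]_n) : 'rV[R]_m -> 'rV[R]_n :=
  fun x => 'D_(X x) V x + christoffel_bilin h (f x) ('D_(X x) f x) (V x).

Definition cov {n} (g : 'rV[R]_n -> 'M[R]_n) (X Y : 'rV[R]_n -> 'rV[R]_n) :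
    'rV[R]_n -> 'rV[R]_n :=
  fun x => 'D_(X x) Y x + christoffel_bilin g x (X x) (Y x).

Definition curvature {n} (g : 'rV[R]_n -> 'M[R]_n)
    (X Y Z : 'rV[R]_n -> 'rV[R]_n) : 'rV[R]_n -> 'rV[R]_n :=
  fun x => cov g X (cov g Y Z) x - cov g Y (cov g X Z) x
           - cov g (bracket X Y) Z x.

(* By tensoriality, R(u,v)w at x is computed from the fields with constant
   coefficients u, v, w. *)
Definition curvature_at {n} (g : 'rV[R]_n -> 'M[R]_n) (x u v w : 'rV[R]_n) :
    'rV[R]_n :=
  curvature g (cst u) (cst v) (cst w) x.

(* Ric(v,w) = tr (u |-> R(u,v)w) *)
Definition ricci {n} (g : 'rV[R]_n -> 'M[R]_n) (x v w : 'rV[R]_n) : R :=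
  \sum_k curvature_at g x (evec k) v w 0 k.

(* (nabla df)(X,Y) = nabla^f_X (df Y) - df (nabla_X Y) *)
Definition second_deriv {m n} (g : 'rV[R]_m -> 'M[R]_m)
    (h : 'rV[R]_n -> 'M[R]_n) (f : 'rV[R]_m -> 'rV[R]_n)
    (X Y : 'rV[R]_m -> 'rV[R]_m) : 'rV[R]_m -> 'rV[R]_n :=
  fun x => cov_along h f X (pushforward f Y) x - pushforward f (cov g X Y) x.

(* In the traces below, the i, j range over the coordinate frame and the
   weights are the inverse metric g^{ij}. *)

Definition tension {m n} (g : 'rV[R]_m -> 'M[R]_m)
    (h : 'rV[R]_n -> 'M[R]_n) (f : 'rV[R]_m -> 'rV[R]_n) :
    'rV[R]_m -> 'rV[R]_n :=
  fun x => \sum_i \sum_j invmx (g x) i j *: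
    second_deriv g h f (cst (evec i)) (cst (evec j)) x.

Definition rough_laplacian {m n} (g : 'rV[R]_m -> 'M[R]_m)
    (h : 'rV[R]_n -> 'M[R]_n) (f : 'rV[R]_m -> 'rV[R]_n)
    (V : 'rV[R]_m -> 'rV[R]_n) : 'rV[R]_m -> 'rV[R]_n :=
  fun x => \sum_i \sum_j invmx (g x) i j *:
    (cov_along h f (cst (evec i)) (cov_along h f (cst (evec j)) V) x
     - cov_along h f (cov g (cst (evec i)) (cst (evec j))) V x).

Definition bitension {m n} (g : 'rV[R]_m -> 'M[R]_m)
    (h : 'rV[R]_n -> 'M[R]_n) (f : 'rV[R]_m -> 'rV[R]_n) :
    'rV[R]_m -> 'rV[R]_n :=
  fun x => rough_laplacian g h f (tension g h f) x
    - \sum_i \sum_j invmx (g x) i j *: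
        curvature_at h (f x) ('D_(evec i) f x) (tension g h f x)
                     ('D_(evec j) f x).

End LocalGeometry.

(* A space with an atlas, and a metric given by its matrix in each chart; the
   axioms are in [riemannian_manifold].  Outside [chart_dom c], resp. its
   image, the values of [coord c], resp. [param c] and [metric c], are junk. *)
Record charted_space (R : realType) (n : nat) := ChartedSpace {
  carrier :> topologicalType;
  chart : Type;
  chart_dom : chart -> set carrier;
  coord : chart -> carrier -> 'rV[R]_n;
  param : chart -> 'rV[R]_n -> carrier;
  metric : chart -> 'rV[R]_n -> 'M[R]_n
}.

Arguments chart_dom {R n c} _ _.
Arguments coord {R n c} _ _.
Arguments param {R n c} _ _.
Arguments metric {R n c} _ _.

Definition transition {R : realType} {n} {M : charted_space R n}
    (a b : chart M) : 'rV[R]_n -> 'rV[R]_n :=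
  coord b \o param a.

Record riemannian_manifold {R : realType} {n : nat} (M : charted_space R n) :
    Prop := RiemannianManifold {
  rm_hausdorff : hausdorff_space M;
  rm_second_countable : @second_countable M;
  rm_connected : connected [set: M];
  rm_cover : forall p : M, exists a : chart M, chart_dom a p;
  rm_open_dom : forall a : chart M, open (chart_dom a);
  rm_open_image : forall a : chart M, open (coord a @` chart_dom a);
  rm_coordK : forall (a : chart M) (p : M),
    chart_dom a p -> param a (coord a p) = p;
  rm_coord_cont : forall (a : chart M) (p : M),
    chart_dom a p -> {for p, continuous (coord a)};
  rm_param_cont : forall (a : chart M) (p : M),
    chart_dom a p -> {for coord a p, continuous (param a)};
  rm_transition : forall a b : chart M,
    smooth_on (coord a @` (chart_dom a `&` chart_dom b)) (transition a b);
  rm_metric_smooth : forall a : chart M,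
    smooth_on (coord a @` chart_dom a) (metric a);
  rm_metric_sym : forall (a : chart M) (p : M), chart_dom a p ->
    (metric a (coord a p))^T = metric a (coord a p);
  rm_metric_pos : forall (a : chart M) (p : M), chart_dom a p ->
    forall u, u != 0 -> 0 < inner (metric a (coord a p)) u u;
  rm_metric_compat : forall (a b : chart M) (p : M),
    chart_dom a p -> chart_dom b p ->
    forall u v, inner (metric a (coord a p)) u v =
      inner (metric b (coord b p))
        (u *m 'J (transition a b) (coord a p))
        (v *m 'J (transition a b) (coord a p))
}.

Definition einstein {R : realType} {n} (L : charted_space R n) : Prop :=
  exists mu : R, forall (a : chart L) (p : L), chart_dom a p ->
    forall v w, ricci (metric a) (coord a p) v w =
                mu * inner (metric a (coord a p)) v w.

(* L x R with the product metric g^L + dt^2; t is the last coordinate *)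
Definition times_line {R : realType} {n} (L : charted_space R n) :
    charted_space R (n + 1) :=
  @ChartedSpace R (n + 1) (L * R)%type (chart L)
    (fun a => [set q | chart_dom a q.1])
    (fun a q => row_mx (coord a q.1) (const_mx q.2))
    (fun a y => (param a (lsubmx y), rsubmx y 0 0))
    (fun a y => block_mx (metric a (lsubmx y)) 0 0 1%:M).

(* Quantities attached to a map phi : M -> Q are given by their components in
   a pair of charts (a, b), meaningful at points of [common_dom phi a b]. *)

Section Maps.
Context {R : realType} {m n : nat}.
Context {M : charted_space R m} {Q : charted_space R n}.
Implicit Types (phi : M -> Q) (a : chart M) (b : chart Q) (p : M).

Definition common_dom phi a b : set M :=
  [set p | chart_dom a p /\ chart_dom b (phi p)].

Definition local_rep phi a b : 'rV[R]_m -> 'rV[R]_n :=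
  coord b \o phi \o param a.

Definition smooth_map phi : Prop :=
  continuous phi /\
  forall a b, smooth_on (coord a @` common_dom phi a b) (local_rep phi a b).

Definition isometric_immersion phi : Prop :=
  smooth_map phi /\
  forall a b p, common_dom phi a b p ->
    forall u v, inner (metric a (coord a p)) u v =
      inner (metric b (coord b (phi p)))
        ('D_u (local_rep phi a b) (coord a p))
        ('D_v (local_rep phi a b) (coord a p)).

Definition hypersurface phi : Prop := n = m.+1 /\ isometric_immersion phi.

Definition lambda_biharmonic (lambda : R) phi : Prop :=
  smooth_map phi /\
  forall a b p, common_dom phi a b p ->
    bitension (metric a) (metric b) (local_rep phi a b) (coord a p)
    - lambda *: tension (metric a) (metric b) (local_rep phi a b) (coord a p)
    = 0.

Definition lambda_biharmonic_hypersurface (lambda : R) phi : Prop :=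
  hypersurface phi /\ lambda_biharmonic lambda phi.

Definition embedded phi : Prop :=
  injective phi /\
  forall U : set M, open U ->
    exists2 O : set Q, open O & phi @` U = O `&` range phi.

(* A vector field xi along phi is given by its components xi b p in the
   frame of each chart b of Q around phi p. *)
Implicit Type xi : chart Q -> M -> 'rV[R]_n.

Definition smooth_field_along phi xi : Prop :=
  (forall b b' p, chart_dom b (phi p) -> chart_dom b' (phi p) ->
     xi b' p = xi b p *m 'J (transition b b') (coord b (phi p))) /\
  (forall a b, smooth_on (coord a @` common_dom phi a b) (xi b \o param a)).

Definition unit_normal_field phi xi : Prop :=
  smooth_field_along phi xi /\
  forall a b p, common_dom phi a b p ->
    inner (metric b (coord b (phi p))) (xi b p) (xi b p) = 1 /\
    forall u, inner (metric b (coord b (phi p)))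
                ('D_u (local_rep phi a b) (coord a p)) (xi b p) = 0.

(* Matrix of (X,Y) |-> <B(X,Y), xi>; for an isometric immersion the second
   fundamental form B is nabla dphi. *)
Definition second_form phi xi a b p : 'M[R]_m :=
  \matrix_(i, j) inner (metric b (coord b (phi p)))
    (second_deriv (metric a) (metric b) (local_rep phi a b)
       (cst (evec i)) (cst (evec j)) (coord a p))
    (xi b p).

(* Acting on row vectors: <u A, v> = <B(u,v), xi> *)
Definition shape_operator phi xi a b p : 'M[R]_m :=
  second_form phi xi a b p *m invmx (metric a (coord a p)).

Definition mean_curvature phi xi a b p : R :=
  m%:R^-1 * \tr (shape_operator phi xi a b p).

Definition totally_umbilical phi xi : Prop :=
  forall a b p, common_dom phi a b p ->
    forall u v, inner (second_form phi xi a b p) u v =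
      mean_curvature phi xi a b p * inner (metric a (coord a p)) u v.

Definition minimal phi xi : Prop :=
  forall a b p, common_dom phi a b p -> mean_curvature phi xi a b p = 0.

End Maps.

Section ProductTarget.
Context {R : realType} {m n : nat}.
Context {M : charted_space R m} {L : charted_space R n}.

(* components of the unit field tangent to the factor R, in every chart *)
Definition dt : 'rV[R]_(n + 1) := row_mx 0 1%:M.

Definition angle (phi : M -> times_line L)
    (xi : chart (times_line L) -> M -> 'rV[R]_(n + 1))
    (b : chart (times_line L)) (p : M) : R :=
  inner (metric b (coord b (phi p))) dt (xi b p).

Definition constant_angle (phi : M -> times_line L)
    (xi : chart (times_line L) -> M -> 'rV[R]_(n + 1)) : Prop :=
  exists c : R, forall (b : chart (times_line L)) (p : M),
    chart_dom b (phi p) -> angle phi xi b p = c.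

(* Locally, phi(M) is an open subset of N x R for a lambda-biharmonic
   hypersurface psi : N -> L.  Immersions being local embeddings, psi is taken
   embedded, so that the subspace N x R of L x R is unambiguous. *)
Definition vertical_cylinder_over_biharmonic (lambda : R)
    (phi : M -> times_line L) : Prop :=
  forall p : M, exists2 U : set M, nbhs p U &
    exists (N : charted_space R m.-1) (psi : N -> L),
      [/\ riemannian_manifold N,
          lambda_biharmonic_hypersurface lambda psi,
          embedded psi &
          exists2 O : set (times_line L), open O &
            phi @` U = O `&` (range psi `*` [set: R])].

End ProductTarget.

(* Main.v *)
(* As dt is parallel, the tangential part T of dt satisfies A T = - grad theta,
   which vanishes for a constant angle; with A = H id this gives H T = 0.  If
   T = 0 at some point, then |theta| = 1 everywhere, so that xi = theta dt is
   parallel and A = 0.  Hence H = 0 in all cases, i.e. the first alternative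
   always holds. *)

Require Import Defs.
From mathcomp Require Import all_boot all_order all_algebra.
From mathcomp Require Import all_classical all_reals all_analysis.
From mathcomp Require Import ring.
Import Order.TTheory GRing.Theory Num.Theory.
Import numFieldNormedType.Exports.
Local Open Scope ring_scope.

Set Implicit Arguments.
Unset Strict Implicit.
Unset Printing Implicit Defensive.

(** * Bilinear forms on row vectors *)

Section Inner.
Context {R : realType} {n : nat}.
Implicit Types (G : 'M[R]_n) (u v w : 'rV[R]_n) (k : R).

Lemma innerE G u v : inner G u v = \sum_i \sum_j u 0 i * G i j * v 0 j.
Proof.
rewrite /inner mxE exchange_big; apply: eq_bigr => j _ /=.
by rewrite !mxE mulr_suml.
Qed.

Lemma inner_evec G i j : inner G (evec i) (evec j) = G i j.
Proof. by rewrite /inner /evec trmx_delta -rowE -colE !mxE. Qed.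

Lemma innerDl G u v w : inner G (u + v) w = inner G u w + inner G v w.
Proof. by rewrite /inner !mulmxDl mxE. Qed.

Lemma innerDr G u v w : inner G u (v + w) = inner G u v + inner G u w.
Proof. by rewrite /inner linearD /= mulmxDr mxE. Qed.

Lemma innerZl G k u v : inner G (k *: u) v = k * inner G u v.
Proof. by rewrite /inner -!scalemxAl mxE. Qed.

Lemma innerZr G k u v : inner G u (k *: v) = k * inner G u v.
Proof. by rewrite /inner linearZ /= -scalemxAr mxE. Qed.

Lemma inner_suml (G : 'M[R]_n) I (r : seq I) (a : I -> R)
    (e : I -> 'rV[R]_n) w :
  inner G (\sum_(k <- r) a k *: e k) w = \sum_(k <- r) a k * inner G (e k) w.
Proof.
rewrite /inner !mulmx_suml summxE; apply: eq_bigr => k _.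
by rewrite -!scalemxAl mxE.
Qed.

Lemma inner0l G u : inner G 0 u = 0.
Proof. by rewrite /inner !mul0mx mxE. Qed.

Lemma inner0r G u : inner G u 0 = 0.
Proof. by rewrite /inner trmx0 mulmx0 mxE. Qed.

Lemma inner0 u v : inner 0 u v = 0.
Proof. by rewrite /inner mulmx0 mul0mx mxE. Qed.

Lemma innerC G u v : G^T = G -> inner G u v = inner G v u.
Proof.
move=> Gsym; rewrite /inner -[in RHS]Gsym.
by rewrite -{2}(trmxK v) -mulmxA -!trmx_mul [RHS]mxE mulmxA.
Qed.

Lemma inner_nondegenerate G u : G \in unitmx ->
  (forall w, inner G u w = 0) -> u = 0.
Proof.
move=> Gu u0; rewrite -[u](mulmxK Gu); suff -> : u *m G = 0 by rewrite mul0mx.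
apply/rowP => j; rewrite [RHS]mxE -(u0 (evec j)) /inner /evec trmx_delta.
by rewrite -colE [RHS]mxE.
Qed.

(** A nonzero row [r] of [kermx G] would satisfy [r *m G = 0], hence [inner G r r = 0], against
    positivity. *)
Lemma posdef_unitmx G :
  (forall u, u != 0 -> 0 < inner G u u) -> G \in unitmx.
Proof.
move=> Gpos; rewrite -row_free_unit -kermx_eq0.
apply/eqP/row_matrixP => i; rewrite row0.
apply/eqP; apply: contraT => /Gpos; rewrite /inner.
by rewrite -row_mul mulmx_ker row0 mul0mx mxE ltxx.
Qed.

End Inner.

(** * Derivatives of matrix-valued maps *)

Section MatrixCalculus.
Local Open Scope classical_set_scope.
Context {R : realType} {V : normedModType R}.

Lemma is_derive_mxP {m n} (M : V -> 'M[R]_(m, n)) x v dM :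
  is_derive x v M dM <-> forall i j, is_derive x v (fun y => M y i j) (dM i j).
Proof.
split=> [[dvM dME] i j|dvM].
  have := dvM; move/derivable_mxP => /(_ i j) dij.
  by apply: DeriveDef => //; rewrite -dME derive_mx // mxE.
have Mx : derivable M x v by apply/derivable_mxP => i j; case: (dvM i j).
apply: DeriveDef => //; apply/matrixP => i j; rewrite derive_mx // mxE.
by case: (dvM i j).
Qed.

Lemma is_derive_mulmx {m n p} (A : V -> 'M[R]_(m, n)) (B : V -> 'M[R]_(n, p))
    x v dA dB : is_derive x v A dA -> is_derive x v B dB ->
  is_derive x v (fun y => A y *m B y) (dA *m B x + A x *m dB).
Proof.
move=> /is_derive_mxP hA /is_derive_mxP hB; apply/is_derive_mxP => i j.
rewrite (_ : (fun _ => _) =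
  \sum_(k < n) ((fun y => A y i k) * (fun y => B y k j))); last first.
  by apply/funext => y; rewrite mxE fct_sumE.
rewrite !mxE -big_split /=; apply: is_derive_sum => k.
have Ak := hA i k; have Bk := hB k j.
by apply: is_derive_eq (is_deriveM Ak Bk) _; rewrite addrC /GRing.scale /= (mulrC (B x k j)).
Qed.

Lemma is_derive_inner {n} (G : V -> 'M[R]_n) (A B : V -> 'rV[R]_n)
    x v dG dA dB :
  is_derive x v G dG -> is_derive x v A dA -> is_derive x v B dB ->
  is_derive x v (fun y => inner (G y) (A y) (B y))
    (inner dG (A x) (B x) + inner (G x) dA (B x) + inner (G x) (A x) dB).
Proof.
move=> hG hA hB.
have hBT : is_derive x v (fun y => (B y)^T) dB^T.
  apply/is_derive_mxP => i j; move/is_derive_mxP : hB => /(_ j i) hB.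
  rewrite mxE (_ : (fun _ => _) = (fun y => B y j i)) //.
  by apply/funext => y; rewrite mxE.
have /is_derive_mxP/(_ 0 0) := is_derive_mulmx (is_derive_mulmx hA hG) hBT.
move=> h; apply: (is_derive_eq h).
by rewrite mulmxDl mxE [X in X + _]mxE /inner [X in X + _]addrC.
Qed.

(** Expanding in the basis [delta_mx i j] leaves a finite sum of scalar functions times fixed
    matrices. *)
Lemma differentiable_mx {m n} (M : V -> 'M[R]_(m, n)) x :
  (forall i j, differentiable (fun y => M y i j) x) -> differentiable M x.
Proof.
move=> dM; rewrite (_ : M = \sum_(i < m) \sum_(j < n)
    (fun y => M y i j *: (delta_mx i j : 'M[R]_(m, n)))); last first.
  apply/funext => y; rewrite {1}[M y]matrix_sum_delta fct_sumE.
  by apply: eq_bigr => i _; rewrite fct_sumE.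
apply: differentiable_sum => i; apply: differentiable_sum => j.
exact: differentiableZl.
Qed.

Lemma derive_chain {n} {W : normedModType R} (h : 'rV[R]_n -> W)
    (f : V -> 'rV[R]_n) x v :
  differentiable f x -> differentiable h (f x) ->
  is_derive x v (h \o f) ('D_('D_v f x) h (f x)).
Proof.
move=> df dh; have dhf := differentiable_comp df dh.
apply: DeriveDef; first exact: diff_derivable.
by rewrite !deriveE // diff_comp.
Qed.

End MatrixCalculus.

(** * The Levi-Civita connection in coordinates *)

Section Connection.
Local Open Scope classical_set_scope.
Context {R : realType}.

(** The differential is linear in its direction, so a derivative along any vector reduces to those
    along the coordinate frame, of which [christoffel] is made. *)
Lemma inner_derive_sum {n} (h : 'rV[R]_n -> 'M[R]_n) x a v w :
  differentiable h x ->
  inner ('D_a h x) v w = \sum_i a 0 i * inner ('D_(evec i) h x) v w.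
Proof.
move=> dh; rewrite deriveE // {1}[a]row_sum_delta linear_sum.
rewrite /inner mulmx_sumr mulmx_suml summxE; apply: eq_bigr => i _.
by rewrite deriveE // linearZ /= -scalemxAr -scalemxAl mxE.
Qed.

(* Koszul formula for fields with constant coefficients. *)
Lemma inner_christoffel {n} (h : 'rV[R]_n -> 'M[R]_n) x u v w :
  differentiable h x -> (h x)^T = h x -> h x \in unitmx ->
  inner (h x) (christoffel_bilin h x u v) w =
    2^-1 * (inner ('D_u h x) v w + inner ('D_v h x) u w - inner ('D_w h x) u v).
Proof.
move=> dh hsym hu.
(* Twice the Christoffel symbol with all indices lowered. [X] contracts it with [u] and [v]; the
   inverse metric then raises the index [l]. *)
pose S i j l := 'D_(evec i) (fun y => h y j l) x
  + 'D_(evec j) (fun y => h y i l) x - 'D_(evec l) (fun y => h y i j) x.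
pose X : 'rV[R]_n := \row_l \sum_i \sum_j u 0 i * v 0 j * S i j l.
have DE i j l : 'D_(evec i) (fun y => h y j l) x = 'D_(evec i) h x j l.
  by rewrite derive_mx ?mxE //; exact: diff_derivable.
have -> : christoffel_bilin h x u v = 2^-1 *: (X *m (invmx (h x))^T).
  apply/rowP => k; rewrite !mxE mulr_sumr.
  under [RHS]eq_bigr => l _ do rewrite !mxE mulr_suml mulr_sumr.
  rewrite [RHS]exchange_big; apply: eq_bigr => i _ /=.
  under [RHS]eq_bigr => l _ do rewrite mulr_suml mulr_sumr.
  rewrite [RHS]exchange_big; apply: eq_bigr => j _ /=.
  rewrite /christoffel !mulr_sumr; apply: eq_bigr => l _.
  by rewrite /S; ring.
rewrite innerZl; congr (_ * _).
(* Pairing with [h x] undoes the raising: by symmetry, [(invmx (h x))^T *m h x] is the transpose of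
   [h x *m invmx (h x)]. *)
rewrite {1}/inner -(mulmxA X) -{2}hsym -trmx_mul mulmxV // trmx1 mulmx1.
rewrite !(inner_derive_sum _ _ _ dh) mxE.
(* The three Koszul terms are brought to sums over the same [i], [j], [l] with weight
   [u 0 i * v 0 j * w 0 l], then compared summand by summand. *)
have -> : \sum_i u 0 i * inner ('D_(evec i) h x) v w =
    \sum_i \sum_j \sum_l u 0 i * v 0 j * w 0 l * 'D_(evec i) h x j l.
  apply: eq_bigr => i _; rewrite innerE mulr_sumr; apply: eq_bigr => j _.
  by rewrite mulr_sumr; apply: eq_bigr => l _; ring.
have -> : \sum_j v 0 j * inner ('D_(evec j) h x) u w =
    \sum_i \sum_j \sum_l u 0 i * v 0 j * w 0 l * 'D_(evec j) h x i l.
  rewrite [RHS]exchange_big; apply: eq_bigr => j _.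
  rewrite innerE mulr_sumr; apply: eq_bigr => i _.
  by rewrite mulr_sumr; apply: eq_bigr => l _; ring.
have -> : \sum_l w 0 l * inner ('D_(evec l) h x) u v =
    \sum_i \sum_j \sum_l u 0 i * v 0 j * w 0 l * 'D_(evec l) h x i j.
  under [RHS]eq_bigr => i _ do rewrite exchange_big.
  rewrite [RHS]exchange_big; apply: eq_bigr => l _.
  rewrite innerE mulr_sumr; apply: eq_bigr => i _.
  by rewrite mulr_sumr; apply: eq_bigr => j _; ring.
under eq_bigr => l _ do rewrite !mxE mulr_suml.
rewrite exchange_big -big_split -sumrB /=; apply: eq_bigr => i _.
under eq_bigr => l _ do rewrite mulr_suml.
rewrite exchange_big -big_split -sumrB /=; apply: eq_bigr => j _.
rewrite -big_split -sumrB /=; apply: eq_bigr => l _.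
by rewrite /S !DE; ring.
Qed.

Lemma christoffel_bilinZr {n} (h : 'rV[R]_n -> 'M[R]_n) x u k v :
  christoffel_bilin h x u (k *: v) = k *: christoffel_bilin h x u v.
Proof.
apply/rowP => l; rewrite !mxE mulr_sumr; apply: eq_bigr => i _.
by rewrite mulr_sumr; apply: eq_bigr => j _; rewrite mxE; ring.
Qed.

(** Metric compatibility: when the two Koszul formulas are added, only the derivative along [u]
    survives. This uses that the derivative of [h] is symmetric, hence the symmetry of [h] near [x]
    and not only at [x]. *)
Lemma christoffel_bilin_compat {n} (h : 'rV[R]_n -> 'M[R]_n) x u v w :
  differentiable h x -> (\forall y \near x, (h y)^T = h y) ->
  h x \in unitmx ->
  inner ('D_u h x) v w =
    inner (h x) (christoffel_bilin h x u v) w +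
    inner (h x) v (christoffel_bilin h x u w).
Proof.
move=> dh hsym hu; have hxsym := nbhs_singleton hsym.
have dsym : ('D_u h x)^T = 'D_u h x.
  apply/matrixP => i j; have dha := diff_derivable (v := u) dh.
  rewrite mxE !derive_mx // !mxE; apply: near_eq_derive.
  by apply: filterS hsym => y /matrixP/(_ i j); rewrite mxE.
rewrite [X in _ + X]innerC // !inner_christoffel //.
rewrite (innerC w v dsym).
by field.
Qed.

(** The chain rule yields the derivative of the metric along [f], and metric compatibility splits it
    into the Christoffel terms of the two covariant derivatives. *)
Lemma derive_inner_along {m n} (h : 'rV[R]_n -> 'M[R]_n)
    (f : 'rV[R]_m -> 'rV[R]_n) X V W x :
  differentiable h (f x) -> (\forall y \near f x, (h y)^T = h y) ->
  h (f x) \in unitmx -> differentiable f x ->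
  derivable V x (X x) -> derivable W x (X x) ->
  'D_(X x) (fun y => inner (h (f y)) (V y) (W y)) x =
    inner (h (f x)) (cov_along h f X V x) (W x) +
    inner (h (f x)) (V x) (cov_along h f X W x).
Proof.
move=> dh hsym hu df dV dW.
have hf := derive_chain (X x) df dh.
have [_ ->] := is_derive_inner hf (derivableP dV) (derivableP dW).
rewrite /= (christoffel_bilin_compat _ _ _ dh) // /cov_along innerDl innerDr.
by ring.
Qed.

End Connection.

(** * Second fundamental form under a constant angle *)

Section UmbilicHypersurface.
Local Open Scope classical_set_scope.
Context {R : realType}.

(** Differentiating [<df(Y), xi> = 0] along [X] moves the derivative onto [xi]; the term
    [df(nabla_X Y)] of [second_deriv] is tangent, so it pairs to zero with [xi]. *)
Lemma weingarten {m n} (g : 'rV[R]_m -> 'M[R]_m) (h : 'rV[R]_n -> 'M[R]_n)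
    (f : 'rV[R]_m -> 'rV[R]_n) (xi : 'rV[R]_m -> 'rV[R]_n) X Y x :
  differentiable h (f x) -> (\forall y \near f x, (h y)^T = h y) ->
  h (f x) \in unitmx -> differentiable f x ->
  derivable (Defs.pushforward f Y) x (X x) -> derivable xi x (X x) ->
  (\forall y \near x, forall u, inner (h (f y)) ('D_u f y) (xi y) = 0) ->
  inner (h (f x)) (second_deriv g h f X Y x) (xi x) =
    - inner (h (f x)) ('D_(Y x) f x) (cov_along h f X xi x).
Proof.
move=> dh hsym hu df dY dxi fxi.
rewrite /second_deriv innerDl -scaleN1r innerZl.
rewrite {2}/Defs.pushforward (nbhs_singleton fxi) mulr0 addr0; apply/eqP.
rewrite -subr_eq0 opprK -(derive_inner_along dh hsym hu df dY dxi).
rewrite (near_eq_derive (g := cst 0)) ?derive_cst //.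
by apply: filterS fxi => y; exact.
Qed.

(* At a point where the angle is c, write d = df(u) + c xi.  If u != 0, then
   B(., u) = - <df(u), nabla xi> vanishes, since <d, xi> and <xi, xi> are
   constant and d is parallel.  Otherwise c^2 = 1, hence xi = c d nearby is
   parallel, and B = 0. *)
Lemma second_form_isotropic {m} (g : 'rV[R]_m -> 'M[R]_m)
    (h : 'rV[R]_(m + 1) -> 'M[R]_(m + 1)) (f xi : 'rV[R]_m -> 'rV[R]_(m + 1))
    (d : 'rV[R]_(m + 1)) (c : R) (x : 'rV[R]_m) :
  (0 < m)%N ->
  differentiable h (f x) -> (\forall y \near f x, (h y)^T = h y) ->
  (\forall y \near x, forall w, w != 0 -> 0 < inner (h (f y)) w w) ->
  differentiable f x -> (forall v, differentiable (fun y => 'D_v f y) x) ->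
  differentiable xi x -> (forall u, 'D_u f x = 0 -> u = 0) ->
  (\forall y \near x, forall u, inner (h (f y)) ('D_u f y) (xi y) = 0) ->
  (\forall y \near x, inner (h (f y)) (xi y) (xi y) = 1) ->
  (\forall y \near x, inner (h (f y)) d (xi y) = c) ->
  (\forall y \near x, inner (h (f y)) d d = 1) ->
  (forall v, christoffel_bilin h (f x) v d = 0) ->
  exists2 u : 'rV[R]_m, u != 0 &
    inner (\matrix_(i, j) inner (h (f x))
      (second_deriv g h f (cst (evec i)) (cst (evec j)) x) (xi x)) u u = 0.
Proof.
move=> m0 dh hsym hpos df ddf dxi imm fxi xi1 dxic dd1 Gd.
have hu := posdef_unitmx (nbhs_singleton hpos).
have hxsym : (h (f x))^T = h (f x) := nbhs_singleton hsym.
pose N i := cov_along h f (cst (evec i)) xi x.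
set B := matrix_of_fun _ _.
have BE i j : B i j = - inner (h (f x)) ('D_(evec j) f x) (N i).
  rewrite mxE (weingarten g (Y := cst (evec j)) dh hsym) //.
    exact/diff_derivable/ddf.
  exact: diff_derivable.
pose J := jacobian f x.
have JE u : 'D_u f x = u *m J by apply: deriveEjacobian.
(* The rows of [K] are the tangent vectors [df(e_j)] followed by [xi]; once [K] is invertible, [d]
   can be decomposed in this frame. *)
pose K := col_mx J (xi x).
have Ku : K \in unitmx.
  rewrite -row_free_unit -kermx_eq0; apply/eqP/row_matrixP => i; rewrite row0.
  have := row_mul i (kermx K) K; rewrite mulmx_ker row0.
  (* A kernel row is a relation [df(v) + s xi = 0]: pairing with [xi] gives [s = 0], and then [imm]
     gives [v = 0]. *)
  set r := row i _; rewrite -[r]hsubmxK mul_row_col => /esym r0.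
  set s := rsubmx r 0 0; have sE : rsubmx r = s%:M by rewrite -mx11_scalar.
  move: r0; rewrite sE mul_scalar_mx -JE => r0.
  have s0 : s = 0.
    have : inner (h (f x)) ('D_(lsubmx r) f x + s *: xi x) (xi x) = 0.
      by rewrite r0 inner0l.
    rewrite innerDl innerZl (nbhs_singleton fxi) (nbhs_singleton xi1).
    by rewrite add0r mulr1.
  move: r0; rewrite s0 scale0r addr0 => /imm ->.
  by rewrite raddf0 row_mx0.
pose r := d *m invmx K; pose u := lsubmx r.
have dE : d = 'D_u f x + c *: xi x.
  have dE' : d = 'D_u f x + rsubmx r 0 0 *: xi x.
    rewrite JE -mul_scalar_mx -mx11_scalar -mul_row_col hsubmxK.
    by rewrite mulmxKV.
  (* Pairing with [xi] identifies the normal coordinate of [d] as the angle [c]. *)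
  rewrite [LHS]dE'; congr (_ + _ *: _).
  rewrite -(nbhs_singleton dxic) {1}dE' innerDl innerZl (nbhs_singleton fxi).
  by rewrite (nbhs_singleton xi1) add0r mulr1.
have [u0|u0] := eqVneq u 0; last first.
  (* Each row of the double sum vanishes separately, being [- u_i <df(u), N i>]. *)
  exists u => //; rewrite innerE big1 // => i _.
  have Du : 'D_u f x = \sum_j u 0 j *: 'D_(evec j) f x.
    rewrite JE {1}[u]row_sum_delta mulmx_suml; apply: eq_bigr => j _.
    by rewrite JE -scalemxAl.
  have -> : \sum_j u 0 i * B i j * u 0 j =
      - u 0 i * inner (h (f x)) ('D_u f x) (N i).
    rewrite Du inner_suml mulr_sumr; apply: eq_bigr => j _.
    by rewrite BE; ring.
  (* A field [V] along [f] with locally constant normal component satisfies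
     [<V, N i> = - <nabla_i V, xi>]. It is applied to [d], which is parallel, and to [xi], for which
     it says that [<xi, N i>] is its own opposite. *)
  have fxN V : derivable V x (evec i) ->
      (\forall y \near x, inner (h (f y)) (V y) (xi y) =
                          inner (h (f x)) (V x) (xi x)) ->
      inner (h (f x)) (V x) (N i) =
      - inner (h (f x)) (cov_along h f (cst (evec i)) V x) (xi x).
    move=> dV Vxi; apply/eqP; rewrite -subr_eq0 opprK addrC.
    rewrite -(derive_inner_along (X := cst (evec i)) dh hsym hu df dV) //.
      by rewrite (near_eq_derive _ Vxi) derive_cst.
    exact: diff_derivable.
  have dN : inner (h (f x)) d (N i) = 0.
    rewrite (fxN (cst d)) //=.
      by rewrite /cov_along derive_cst Gd addr0 inner0l oppr0.
    by apply: (filterS _ dxic) => y ->; rewrite (nbhs_singleton dxic).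
  have xiN : inner (h (f x)) (xi x) (N i) = 0.
    have := fxN xi (diff_derivable dxi).
    rewrite -/(N i) (innerC (N i)) // => xiN.
    have {}xiN : inner (h (f x)) (xi x) (N i) *+ 2 = 0.
      rewrite mulr2n {1}xiN ?addNr //.
      by apply: (filterS _ xi1) => y ->; rewrite (nbhs_singleton xi1).
    by apply/eqP; move/eqP : xiN; rewrite mulrn_eq0.
  move: dN; rewrite {1}dE innerDl innerZl xiN mulr0 addr0 => ->.
  by rewrite mulr0.
have Df0 : 'D_u f x = 0 by rewrite u0 derive0.
have dxi0 : d = c *: xi x by rewrite {1}dE Df0 add0r.
have cc : c * c = 1.
  rewrite -(nbhs_singleton dd1) dxi0 innerZl innerZr.
  by rewrite (nbhs_singleton xi1) mulr1.
have xiE : \forall y \near x, xi y = cst (c *: d) y.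
  near=> y.
  have hyD : inner (h (f y)) d (xi y) = c by near: y.
  have hyX : inner (h (f y)) (xi y) (xi y) = 1 by near: y.
  have hyd : inner (h (f y)) d d = 1 by near: y.
  have hsy : (h (f y))^T = h (f y).
    by near: y; exact: (differentiable_continuous df hsym).
  have hpy w : w != 0 -> 0 < inner (h (f y)) w w by move: w; near: y.
  (* The squared norm of [xi y - c d] is [1 - 2 c^2 + c^2 = 1 - c^2 = 0], so positivity forces this
     vector to vanish. *)
  apply/eqP; rewrite -subr_eq0; apply: contraT => /hpy; rewrite -scaleN1r.
  rewrite /= !(innerDl, innerDr, innerZl, innerZr).
  rewrite (innerC (xi y) d) // hyD hyX hyd.
  have -> : 1 + -1 * (c * c) + (-1 * (c * c) + -1 * (c * (-1 * (c * 1)))) =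
    1 - c * c by ring.
  by rewrite cc subrr ltxx.
have N0 i : N i = 0.
  rewrite /N /cov_along (near_eq_derive _ xiE) derive_cst add0r.
  by rewrite (nbhs_singleton xiE) christoffel_bilinZr Gd scaler0.
(* Here all of [B] vanishes, so any nonzero vector serves; [0 < m] provides the first basis
   vector. *)
exists (evec (Ordinal m0)).
  apply/eqP => /rowP/(_ (Ordinal m0))/eqP.
  by rewrite !mxE !eqxx oner_eq0.
by rewrite inner_evec BE N0 inner0r oppr0.
Unshelve. all: by end_near. Qed.

End UmbilicHypersurface.

(** * The product metric and its parallel field [dt] *)

Section ProductMetric.
Local Open Scope classical_set_scope.
Context {R : realType} {n : nat}.
Implicit Types (G : 'M[R]_n) (u v : 'rV[R]_(n + 1)).

Lemma inner_block G u v :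
  inner (block_mx G 0 0 1%:M) u v =
    inner G (lsubmx u) (lsubmx v) + rsubmx u 0 0 * rsubmx v 0 0.
Proof.
rewrite /inner -[u in LHS]hsubmxK -[v in LHS]hsubmxK mul_row_block.
rewrite tr_row_mx mul_row_col !mulmx0 addr0 add0r mulmx1 mxE; congr (_ + _).
by rewrite mxE big_ord1 [X in _ * X = _]mxE.
Qed.

Lemma inner_block_dt G v : inner (block_mx G 0 0 1%:M) v dt = rsubmx v 0 0.
Proof. by rewrite inner_block row_mxKl row_mxKr inner0r add0r [X in _ * X]mxE mulr1. Qed.

Lemma tr_block G : G^T = G ->
  (block_mx G 0 0 1%:M : 'M[R]_(n + 1))^T = block_mx G 0 0 1%:M.
Proof. by move=> Gsym; rewrite tr_block_mx Gsym !trmx0 trmx1. Qed.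

Lemma inner_block_gt0 G u : (forall w, w != 0 -> 0 < inner G w w) ->
  u != 0 -> 0 < inner (block_mx G 0 0 1%:M) u u.
Proof.
move=> Gpos u0; rewrite inner_block -expr2.
have [l0|/Gpos l0] := eqVneq (lsubmx u) 0; last first.
  by rewrite ltr_pwDl // sqr_ge0.
rewrite l0 inner0l add0r lt_def sqr_ge0 andbT sqrf_eq0.
apply: contra_neq u0 => r0; rewrite -[u]hsubmxK l0 [rsubmx u]mx11_scalar r0.
by rewrite raddf0 row_mx0.
Qed.

Variable g : 'rV[R]_n -> 'M[R]_n.
Let P (y : 'rV[R]_(n + 1)) : 'M[R]_(n + 1) := block_mx (g (lsubmx y)) 0 0 1%:M.

Lemma differentiable_block y : differentiable g (lsubmx y) -> differentiable P y.
Proof.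
move=> dg; have dgl := differentiable_comp (differentiable_lsubmx y) dg.
apply: differentiable_mx => i j.
case: (split_ordP i) => i' ->; case: (split_ordP j) => j' ->.
- rewrite (_ : (fun _ => _) = (fun M : 'M[R]_n => M i' j') \o (g \o lsubmx)).
    by apply: differentiable_comp => //; exact: differentiable_coord.
  by apply/funext => z; rewrite /P block_mxEul.
- rewrite (_ : (fun _ => _) = cst 0) //.
  by apply/funext => z; rewrite /P block_mxEur mxE.
- rewrite (_ : (fun _ => _) = cst 0) //.
  by apply/funext => z; rewrite /P block_mxEdl mxE.
- rewrite (_ : (fun _ => _) = cst ((1%:M : 'M[R]_1) i' j')) //.
  by apply/funext => z; rewrite /P block_mxEdr.
Qed.

(** All three Koszul terms vanish: the metric does not depend on the last coordinate, and the
    pairing of a fixed vector with [dt] is the same at every point. *)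
Lemma christoffel_bilin_dt y v :
  differentiable g (lsubmx y) -> (g (lsubmx y))^T = g (lsubmx y) ->
  P y \in unitmx -> christoffel_bilin P y v dt = 0.
Proof.
move=> dg gsym Pu; have dP := differentiable_block dg.
have Psym : (P y)^T = P y by exact: tr_block.
apply: (inner_nondegenerate Pu) => w.
(* Moving along [dt] leaves [lsubmx] unchanged, so the difference quotient is identically zero. *)
have Ddt : 'D_dt P y = 0.
  rewrite /derive (_ : (fun _ => _) = cst 0) ?lim_cst //.
  apply/funext => k /=; rewrite /P.
  have -> : lsubmx (k *: dt + y) = lsubmx y.
    by rewrite linearP /= row_mxKl scaler0 add0r.
  by rewrite subrr scaler0.
have dtD a b : inner ('D_a P y) b dt = 0.
  have dPa : is_derive y a P ('D_a P y) by apply/derivableP/diff_derivable.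
  have [_] := is_derive_inner dPa (is_derive_cst b y a) (is_derive_cst dt y a).
  rewrite inner0l inner0r !addr0 => <-.
  rewrite (_ : (fun _ => _) = cst (rsubmx b 0 0)) ?derive_cst //.
  by apply/funext => z; rewrite inner_block_dt.
have dtD' a b : inner ('D_a P y) dt b = 0.
  have dPa : is_derive y a P ('D_a P y) by apply/derivableP/diff_derivable.
  have [_] := is_derive_inner dPa (is_derive_cst dt y a) (is_derive_cst b y a).
  rewrite inner0l inner0r !addr0 => <-.
  rewrite (_ : (fun _ => _) = cst (rsubmx b 0 0)) ?derive_cst //.
  apply/funext => z; rewrite inner_block row_mxKl row_mxKr inner0l add0r.
  by rewrite [X in X * _]mxE mul1r.
rewrite inner_christoffel // dtD' dtD Ddt.
by rewrite inner0 subr0 addr0 mulr0.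
Qed.

End ProductMetric.

(** * From local coordinates to the hypersurface *)

Section Charts.
Local Open Scope classical_set_scope.
Context {R : realType}.

(** Identities known on the common domain thus hold near the coordinate point and may be
    differentiated there. The neighbourhood is obtained by pulling the open common domain back
    through [param a]. *)
Lemma nbhs_common_dom {m n} (M : charted_space R m) (L : charted_space R n)
    (phi : M -> times_line L) a b p :
  riemannian_manifold M -> riemannian_manifold L -> continuous phi ->
  common_dom phi a b p -> nbhs (Defs.coord a p) (Defs.coord a @` common_dom phi a b).
Proof.
move=> RM RL cphi [ap bp].
have pN : nbhs p (common_dom phi a b).
  apply: filterI; first exact: open_nbhs_nbhs (conj (rm_open_dom RM a) ap).
  apply: cphi.
  have : nbhs (phi p).1 (chart_dom (b : chart L)).
    exact: open_nbhs_nbhs (conj (rm_open_dom RL b) bp).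
  exact: (@cvg_fst _ _ (nbhs (phi p).1) (nbhs (phi p).2) _).
have xN : nbhs (Defs.coord a p) (Defs.coord a @` chart_dom a).
  by apply: open_nbhs_nbhs; split; [exact: rm_open_image|exists p].
rewrite -(rm_coordK RM ap) in pN; have xN' := rm_param_cont RM ap pN.
apply: filterS2 xN xN' => _ [q aq <-].
by rewrite /= (rm_coordK RM aq) => dq; exists q.
Qed.

End Charts.

Theorem theorem4p3 (R : realType) (m : nat) (L M : charted_space R m)
    (lambda : R) (phi : M -> times_line L)
    (xi : chart (times_line L) -> M -> 'rV[R]_(m + 1)) :
  (0 < m)%N ->
  riemannian_manifold L -> einstein L ->
  riemannian_manifold M ->
  0 <= lambda ->
  lambda_biharmonic_hypersurface lambda phi ->
  unit_normal_field phi xi ->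
  totally_umbilical phi xi ->
  constant_angle phi xi ->
  minimal phi xi \/ vertical_cylinder_over_biharmonic lambda phi.
Proof.
move=> m0 RL _ RM _ [[_ [[cphi sphi] iso]] _] [[_ sxi] nxi] umb [c angle_c].
left=> a b p dp; have [ap bp] := dp.
have xK : param a (Defs.coord a p) = p := rm_coordK RM ap.
pose f := local_rep phi a b; pose h := metric b; pose g := metric a.
set x := Defs.coord a p in xK *.
have fE : f x = Defs.coord b (phi p) by rewrite /f /local_rep /= xK.
have Nx := nbhs_common_dom RM RL cphi dp.
have Dx : (Defs.coord a @` common_dom phi a b)%classic x by exists p.
have lE q : lsubmx (Defs.coord b (phi q)) = Defs.coord (b : chart L) (phi q).1.
  exact: row_mxKl.
(* Order two: [second_deriv] differentiates the first derivatives of [f] once more. *)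
have [df /(_ _)/= ddf] := sphi a b 2%N.
have [dxi _] := sxi a b 1%N.
have [dg _] := rm_metric_smooth RL b 1%N.
have dgb : differentiable (metric (b : chart L)) (lsubmx (f x)).
  by rewrite fE lE; apply: dg; exists (phi p).1.
have near_x (P : 'rV[R]_m -> M -> Prop) :
    (forall q, common_dom phi a b q -> P (Defs.coord a q) q) ->
    \forall y \near x, P y (param a y).
  move=> PD; apply: filterS Nx => _ [q dq <-].
  by rewrite (rm_coordK RM dq.1); exact: PD.
have hpos : \forall y \near x, forall w, w != 0 -> 0 < inner (h (f y)) w w.
  apply: (near_x (fun _ q => forall w, w != 0 ->
    0 < inner (h (Defs.coord b (phi q))) w w)) => q [_ bq] w.
  by apply: inner_block_gt0 => v; rewrite lE; exact: rm_metric_pos.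
have fxi : \forall y \near x, forall u,
    inner (h (f y)) ('D_u f y) ((xi b \o param a) y) = 0.
  apply: (near_x (fun y q => forall u,
    inner (h (Defs.coord b (phi q))) ('D_u f y) (xi b q) = 0)) => q dq.
  exact: (nxi a b q dq).2.
have xi1 : \forall y \near x,
    inner (h (f y)) ((xi b \o param a) y) ((xi b \o param a) y) = 1.
  apply: (near_x (fun _ q =>
    inner (h (Defs.coord b (phi q))) (xi b q) (xi b q) = 1)) => q dq.
  exact: (nxi a b q dq).1.
have dtxi : \forall y \near x, inner (h (f y)) dt ((xi b \o param a) y) = c.
  apply: (near_x (fun _ q =>
    inner (h (Defs.coord b (phi q))) dt (xi b q) = c)) => q [_ bq].
  exact: angle_c.
have dtdt : \forall y \near x, inner (h (f y)) dt dt = 1.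
  by apply: (@nearW _ (nbhs x)) => y; rewrite inner_block_dt row_mxKr mxE.
(* This neighbourhood lies in the target and extends off the image of [phi], so it comes from the
   chart image in [L], pulled back by [lsubmx]. *)
have hsym : \forall y \near f x, (h y)^T = h y.
  have bN : nbhs (lsubmx (f x))
      (Defs.coord (b : chart L) @` chart_dom (b : chart L))%classic.
    apply: open_nbhs_nbhs; split; first exact: rm_open_image.
    by rewrite fE lE; exists (phi p).1.
  have bN' : nbhs (f x) (lsubmx @^-1`
      (Defs.coord (b : chart L) @` chart_dom (b : chart L)))%classic.
    exact: (differentiable_continuous (differentiable_lsubmx (f x)) bN).
  apply: filterS bN' => y [q bq qy].
  by apply: tr_block; rewrite -qy; exact: rm_metric_sym.
have hu := posdef_unitmx (nbhs_singleton hpos).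
have Gdt v : christoffel_bilin h (f x) v dt = 0.
  apply: christoffel_bilin_dt => //; rewrite fE lE; exact: rm_metric_sym.
(* An isometric map is an immersion because the metric of [M] is positive definite. *)
have imm u : 'D_u f x = 0 -> u = 0.
  move=> Du0; apply/eqP; apply: contraT => /(rm_metric_pos RM ap).
  by rewrite (iso a b p dp) Du0 inner0l ltxx.
have [u u0] := second_form_isotropic g m0 (differentiable_block dgb) hsym hpos
  (df _ Dx) (fun v => (ddf v).1 _ Dx) (dxi _ Dx) imm fxi xi1 dtxi dtdt Gdt.
(* Umbilicity at the isotropic vector [u] reads [0 = H g(u, u)] with [g(u, u) > 0]. *)
rewrite /= xK fE => B0; have := umb a b p dp u u.
rewrite /second_form [LHS]B0 => /esym/eqP; rewrite mulf_eq0 => /orP[/eqP //|].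
by rewrite gt_eqF // (rm_metric_pos RM ap).
Qed.
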